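(* Let $(M^n,g,\phi,\lambda)$ be a manifold with density with $\lambda=0$, with normal weighted ambient metric $\widetilde g=2\,du\,dv+g_u$, $\widetilde\phi=\phi_u-v$. Let $X:=(v_{1,\phi})_u\,\partial_v-\partial_u$, where $(v_{1,\phi})_u:=\frac12\left(R_u+2\Delta_u\phi_u-|\nabla_u\phi_u|^2\right)$. Then there is a formal solution to the $\mathcal F$-gradient Ricci flow along $X$; that is, $$(L_Xg_u)_{ij}=-2[(\mathrm{Ric}_\phi)_u]_{ij}\bmod O(u^\infty),\qquad L_X\widetilde\phi=-(R_u+\Delta\phi_u)\bmod O(u^\infty).$$
   Context: $(M^n,g,\phi,\lambda)$: a Riemannian manifold with $\phi\in C^\infty(M)$, $\lambda\in\mathbb R$. $\mathrm{Ric}_\phi=\mathrm{Ric}+\nabla^2\phi$. For a (pseudo-)Riemannian manifold of dimension $m$ put $P_\phi=\mathrm{Ric}_\phi-\lambda g$, $F_\phi=\Delta\phi-|\nabla\phi|^2+2\lambda\phi-m\lambda$. The normal weighted ambient metric (for $\lambda=0$) is the structure on a neighborhood of $\{u=0\}$ in $\mathbb R_v\times M\times\mathbb R_u$ of the form $\widetilde g=2\,du\,dv+g_u$, $\widetilde\phi=\phi_u-v$, where $(g_u,\phi_u)$ is a smooth one-parameter family with $(g_0,\phi_0)=(g,\phi)$, such that $\widetilde P_\phi=O(u^\infty)$ and $\widetilde F_\phi=O(u^\infty)$ at $u=0$ (computed for $(\widetilde g,\widetilde\phi)$ in dimension $n+2$). It is determined modulo $O(u^\infty)$. A subscript $u$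 on $R$, $\Delta$, $\nabla$, $\mathrm{Ric}_\phi$ means computed with $(g_u,\phi_u)$; $L_X$ is the Lie derivative. The $\mathcal F$-gradient Ricci flow is $\partial_tg=-2\mathrm{Ric}_\phi$, $\partial_t\phi=-R-\Delta\phi$. *)

(* Defs.v *)
From mathcomp Require Import all_boot all_order all_algebra.
From mathcomp Require Import boolp classical_sets functions cardinality.
From mathcomp Require Import reals topology normedtype landau derive.

Set Implicit Arguments.
Unset Strict Implicit.
Unset Printing Implicit Defensive.

Import Order.TTheory GRing.Theory Num.Theory.
Import numFieldNormedType.Exports.

Local Open Scope classical_set_scope.
Local Open Scope ring_scope.

(** * Calculus on open subsets of R^m (points are row vectors) *)

Definition pd (R : realType) (m : nat) (i : 'I_m) (f : 'rV[R]_m -> R) :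
    'rV[R]_m -> R :=
  fun x => 'D_(delta_mx 0 i) f x.

(** C^oo on [U] (used for open [U]): all iterated partial derivatives exist and
    are Frechet differentiable, hence continuous, on [U]. *)
Definition smooth_on (R : realType) (m : nat) (U : set 'rV[R]_m)
    (f : 'rV[R]_m -> R) : Prop :=
  forall (s : seq 'I_m) (x : 'rV[R]_m), U x ->
    differentiable (foldr (@pd R m) f s) x.

(** * Pseudo-Riemannian geometry in a coordinate system *)

(** [g x i j] is the component g_ij at the point with coordinates [x]. *)
Section CoordinateGeometry.
Variables (R : realType) (m : nat).
Variables (g : 'rV[R]_m -> 'M[R]_m) (phi : 'rV[R]_m -> R) (lambda : R).
Implicit Types (x : 'rV[R]_m) (i j k l : 'I_m).

Definition ginv x : 'M[R]_m := invmx (g x).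

(** Gamma^k_ij *)
Definition christoffel k i j x : R :=
  2^-1 * \sum_l ginv x k l *
    (pd i (fun y => g y j l) x + pd j (fun y => g y i l) x
     - pd l (fun y => g y i j) x).

(** R(d_i, d_j) d_k = \sum_l (riemann l k i j) d_l, where
    R(X, Y) = [nabla_X, nabla_Y] - nabla_[X, Y] *)
Definition riemann l k i j x : R :=
  pd i (christoffel l j k) x - pd j (christoffel l i k) x
  + \sum_p (christoffel l i p x * christoffel p j k x
            - christoffel l j p x * christoffel p i k x).

(** Ric(Y, Z) = tr (X |-> R(X, Y) Z); positive on round spheres *)
Definition ricci i j x : R := \sum_k riemann k j k i x.

Definition scalar_curv x : R := \sum_i \sum_j ginv x i j * ricci i j x.

Definition hessian i j x : R :=
  pd i (pd j phi) x - \sum_k christoffel k i j x * pd k phi x.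

Definition laplacian x : R := \sum_i \sum_j ginv x i j * hessian i j x.

Definition grad_sq x : R :=
  \sum_i \sum_j ginv x i j * pd i phi x * pd j phi x.

Definition ric_phi i j x : R := ricci i j x + hessian i j x.

Definition P_phi i j x : R := ric_phi i j x - lambda * g x i j.

Definition F_phi x : R :=
  laplacian x - grad_sq x + 2 * lambda * phi x - m%:R * lambda.

Definition v1_phi x : R :=
  2^-1 * (scalar_curv x + 2 * laplacian x - grad_sq x).

End CoordinateGeometry.

Section LieDerivative.
Variables (R : realType) (m : nat) (X : 'rV[R]_m -> 'rV[R]_m).

Definition lie_fun (f : 'rV[R]_m -> R) (x : 'rV[R]_m) : R :=
  \sum_k X x 0 k * pd k f x.

(** (L_X T)_ij for a (0,2)-tensor field T *)
Definition lie_cov2 (T : 'rV[R]_m -> 'M[R]_m) (i j : 'I_m) (x : 'rV[R]_m) : R :=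
  \sum_k (X x 0 k * pd k (fun y => T y i j) x
          + T x k j * pd i (fun y => X y 0 k) x
          + T x i k * pd j (fun y => X y 0 k) x).

End LieDerivative.

(** * Smooth manifolds with density *)

Record chart (R : realType) (n : nat) (T : topologicalType) := Chart {
  cdom : set T;
  cimg : set 'rV[R]_n;
  cmap : T -> 'rV[R]_n;
  cinv : 'rV[R]_n -> T;
  cdom_open : open cdom;
  cimg_open : open cimg;
  cmap_img : forall p, cdom p -> cimg (cmap p);
  cinv_dom : forall x, cimg x -> cdom (cinv x);
  cmapK : forall p, cdom p -> cinv (cmap p) = p;
  cinvK : forall x, cimg x -> cmap (cinv x) = x;
  cmap_cont : forall p, cdom p -> {for p, continuous cmap};
  cinv_cont : forall x, cimg x -> {for x, continuous cinv}
}.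

Record smooth_manifold (R : realType) (n : nat) := SmoothManifold {
  carrier :> topologicalType;
  manifold_hausdorff : hausdorff_space carrier;
  manifold_second_countable : @second_countable carrier;
  atlas_index : Type;
  atlas : atlas_index -> chart R n carrier;
  atlas_cover : forall p : carrier, exists a, cdom (atlas a) p;
  atlas_compatible : forall (a b : atlas_index) (k : 'I_n),
    smooth_on [set x | cimg (atlas a) x /\ cdom (atlas b) (cinv (atlas a) x)]
              (fun x => cmap (atlas b) (cinv (atlas a) x) 0 k)
}.

(** [transition_jac a b x i k] is the derivative of the k-th coordinate of
    chart [b] in the direction of the i-th coordinate of chart [a]. *)
Definition transition_jac (R : realType) (n : nat) (M : smooth_manifold R n)
    (a b : atlas_index M) (x : 'rV[R]_n) : 'M[R]_n :=
  \matrix_(i, k) pd i (fun y => cmap (atlas b) (cinv (atlas a) y) 0 k) x.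

(** Tensor fields are given by their components in all charts of the atlas,
    subject to the transformation law: [h a x i j] is h(d_i, d_j) at the point
    with coordinates [x] in the chart [a].  Values of [h a] off the image of
    [U] are junk. *)
Definition riemannian_metric (R : realType) (n : nat) (M : smooth_manifold R n)
    (U : set M) (h : atlas_index M -> 'rV[R]_n -> 'M[R]_n) : Prop :=
  [/\ forall a i j, smooth_on
        [set x | cimg (atlas a) x /\ U (cinv (atlas a) x)] (fun x => h a x i j),
      forall a x, cimg (atlas a) x -> U (cinv (atlas a) x) -> (h a x)^T = h a x,
      forall a x, cimg (atlas a) x -> U (cinv (atlas a) x) ->
        forall w : 'rV[R]_n, w != 0 -> 0 < (w *m h a x *m w^T) 0 0
    & forall a b p, cdom (atlas a) p -> cdom (atlas b) p -> U p ->
        let x := cmap (atlas a) p in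
        let J := transition_jac a b x in
        h a x = J *m h b (cmap (atlas b) p) *m J^T].

Record density_manifold (R : realType) (n : nat) := DensityManifold {
  dm_manifold :> smooth_manifold R n;
  dm_g : atlas_index dm_manifold -> 'rV[R]_n -> 'M[R]_n;
  dm_gP : riemannian_metric setT dm_g;
  dm_phi : dm_manifold -> R;
  dm_phi_smooth : forall a,
    smooth_on (cimg (atlas a)) (fun x => dm_phi (cinv (atlas a) x));
  dm_lambda : R
}.

(** * The ambient space *)

(** A chart of [M] gives product coordinates (v, x, u) on R_v * M * R_u, which
    are stored as a row vector of length 1 + n + 1 = n + 2. *)
Section AmbientCoordinates.
Variables (R : realType) (n : nat).

Definition v_idx : 'I_(1 + n + 1) := lshift 1 (lshift n ord0).
Definition x_idx (i : 'I_n) : 'I_(1 + n + 1) := lshift 1 (rshift 1 i).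
Definition u_idx : 'I_(1 + n + 1) := rshift (1 + n) ord0.

Definition v_coord (q : 'rV[R]_(1 + n + 1)) : R := q 0 v_idx.
Definition x_coord (q : 'rV[R]_(1 + n + 1)) : 'rV[R]_n :=
  \row_i q 0 (x_idx i).
Definition u_coord (q : 'rV[R]_(1 + n + 1)) : R := q 0 u_idx.

(** f = O(u^oo) at the points of [U] on {u = 0}, locally uniformly. *)
Definition O_u_infty (U : set 'rV[R]_(1 + n + 1))
    (f : 'rV[R]_(1 + n + 1) -> R) : Prop :=
  forall (N : nat) (q : 'rV[R]_(1 + n + 1)), U q -> u_coord q = 0 ->
    f =O_ (nbhs q) (fun q' => u_coord q' ^+ N).

End AmbientCoordinates.

(** Coordinate image, in the product chart, of a subset of R_v * M * R_u. *)
Definition ambient_img (R : realType) (n : nat) (M : smooth_manifold R n)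
    (W : set (R * M * R)%type) (a : atlas_index M) : set 'rV[R]_(1 + n + 1) :=
  [set q | cimg (atlas a) (x_coord q) /\
           W (v_coord q, cinv (atlas a) (x_coord q), u_coord q)].

(** Families of metrics and functions on M depending on u, with u first. *)
Section AmbientFields.
Variables (R : realType) (n : nat) (M : smooth_manifold R n).
Variables (gu : R -> atlas_index M -> 'rV[R]_n -> 'M[R]_n).
Variables (phiu : R -> M -> R).
Variable (a : atlas_index M).
Implicit Type q : 'rV[R]_(1 + n + 1).

Definition loc_fun (f : M -> R) (x : 'rV[R]_n) : R := f (cinv (atlas a) x).

(** g_u regarded as a (0,2)-tensor on the ambient space *)
Definition gu_tensor q : 'M[R]_(1 + n + 1) :=
  block_mx (block_mx 0 0 0 (gu (u_coord q) a (x_coord q))) 0 0 0.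

(** the symmetric tensor 2 du dv *)
Definition two_du_dv : 'M[R]_(1 + n + 1) :=
  delta_mx (u_idx n) (v_idx n) + delta_mx (v_idx n) (u_idx n).

Definition ambient_g q : 'M[R]_(1 + n + 1) := two_du_dv + gu_tensor q.

Definition ambient_phi q : R :=
  loc_fun (phiu (u_coord q)) (x_coord q) - v_coord q.

(** X = (v_{1,phi})_u d_v - d_u *)
Definition flow_field q : 'rV[R]_(1 + n + 1) :=
  v1_phi (gu (u_coord q) a) (loc_fun (phiu (u_coord q))) (x_coord q)
    *: delta_mx 0 (v_idx n)
  - delta_mx 0 (u_idx n).

End AmbientFields.

(** This normal form is the one for lambda = 0.  [P_phi] and [F_phi] of the
    ambient structure are computed in dimension 1 + n + 1. *)
Record normal_weighted_ambient (R : realType) (n : nat)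
    (D : density_manifold R n) := NormalWeightedAmbient {
  amb_dom : set (R * D * R)%type;
  amb_dom_open : open amb_dom;
  amb_dom_u0 : forall (v : R) (p : D), amb_dom (v, p, 0);
  amb_gu : R -> atlas_index D -> 'rV[R]_n -> 'M[R]_n;
  amb_gu_metric : forall u,
    riemannian_metric [set p | exists v, amb_dom (v, p, u)] (amb_gu u);
  amb_gu_smooth : forall a i j, smooth_on (ambient_img amb_dom a)
    (fun q => amb_gu (u_coord q) a (x_coord q) i j);
  amb_gu0 : forall a x, cimg (atlas a) x -> amb_gu 0 a x = dm_g a x;
  amb_phiu : R -> D -> R;
  amb_phiu_smooth : forall a, smooth_on (ambient_img amb_dom a)
    (fun q => loc_fun a (amb_phiu (u_coord q)) (x_coord q));
  amb_phiu0 : forall p, amb_phiu 0 p = dm_phi p;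
  amb_P : forall a i j, O_u_infty (ambient_img amb_dom a)
    (P_phi (ambient_g amb_gu a) (ambient_phi amb_phiu a) (dm_lambda D) i j);
  amb_F : forall a, O_u_infty (ambient_img amb_dom a)
    (F_phi (ambient_g amb_gu a) (ambient_phi amb_phiu a) (dm_lambda D))
}.

(* Main.v *)
Require Import Defs.
From mathcomp Require Import all_boot all_order all_algebra ring.
From mathcomp Require Import boolp classical_sets functions cardinality.
From mathcomp Require Import reals topology normedtype landau derive.
Import Order.TTheory GRing.Theory Num.Theory.
Import numFieldNormedType.Exports.
Local Open Scope classical_set_scope.
Local Open Scope ring_scope.

(** Since [g~ = 2 du dv + g_u] depends on [(x, u)] only, its geometry is explicit:
    the only Christoffel symbols that matter are those of [g_u] and
    [Gamma^v_ij = - g'_ij / 2], where the prime is [d/du].  Hence the ambient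
    Ricci tensor restricts to that of [g_u], and
    [P~_ij = (Ric_phi)_ij - g'_ij / 2],
    [F~ = Delta phi - tr g' / 2 - |nabla phi|^2 + 2 phi'].
    As [X] is [v_1 d_v - d_u], this gives the exact identities
    [L_X g_u + 2 Ric_phi = 2 P~] and
    [L_X phi~ + R + Delta phi = (tr P~ - F~) / 2], with [tr] the [g_u]-trace, so it
    remains to see that the entries of [g_u^-1] are locally bounded. *)

(** * Directional derivatives compared through their difference quotients *)

Section DirectionalDerivatives.
Context {R : realType}.

(** The two difference quotients are the same function of [h], so their [lim]s agree even where no
    limit exists. This moves partial derivatives between the ambient space and the slices. *)
Lemma derive_translation_eq {V V' : normedModType R} (f : V -> R) (e q : V)
    (f' : V' -> R) (e' q' : V') :
  (forall h, f (h *: e + q) - f q = f' (h *: e' + q') - f' q') ->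
  'D_e f q = 'D_e' f' q'.
Proof.
move=> ff'; rewrite /derive.
have -> : (fun h : R => h^-1 *: ((f \o shift q) (h *: e) - f q)) =
          (fun h : R => h^-1 *: ((f' \o shift q') (h *: e') - f' q')).
  by apply/funext => h /=; rewrite ff'.
by [].
Qed.

Lemma derive_translation_invariant {V : normedModType R} (f : V -> R) (e q : V) :
  (forall h, f (h *: e + q) = f q) -> 'D_e f q = 0.
Proof.
move=> fe; rewrite -(derive_cst (0 : R) q e).
by apply: derive_translation_eq => h; rewrite fe !subrr.
Qed.

Lemma pd_cst {m : nat} (i : 'I_m) (c : R) (q : 'rV[R]_m) : pd i (fun=> c) q = 0.
Proof. exact: derive_translation_invariant. Qed.

End DirectionalDerivatives.

(** * Linear algebra of the block matrix of [2 du dv + B] *)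

Section AmbientBlocks.
Context {R : realType} {n : nat}.
Local Notation Vi := (v_idx n).
Local Notation Xi := (@x_idx n).
Local Notation Ui := (u_idx n).

Variant ambient_idx_spec : 'I_(1 + n + 1) -> Type :=
| AmbientV : ambient_idx_spec Vi
| AmbientX i : ambient_idx_spec (Xi i)
| AmbientU : ambient_idx_spec Ui.

Lemma ambient_idxP (k : 'I_(1 + n + 1)) : ambient_idx_spec k.
Proof.
case: (split_ordP k) => [l ->|l ->].
  case: (split_ordP l) => [z ->|i ->]; last exact: AmbientX.
  by rewrite (ord1 z); exact: AmbientV.
by rewrite (ord1 l); exact: AmbientU.
Qed.

Lemma sum_ambient (F : 'I_(1 + n + 1) -> R) :
  \sum_k F k = F Vi + \sum_i F (Xi i) + F Ui.
Proof. by rewrite !big_split_ord /= !big_ord1. Qed.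

Lemma ambient_idx_eq : (forall i, (Xi i == Vi) = false) * (forall i, (Vi == Xi i) = false)
  * (forall i, (Xi i == Ui) = false) * (forall i, (Ui == Xi i) = false)
  * ((Ui == Vi) = false) * ((Vi == Ui) = false).
Proof.
rewrite /v_idx /x_idx /u_idx.
by do 5?split => *; rewrite ?eq_lshift ?eq_rlshift ?eq_lrshift.
Qed.

Lemma x_idx_eq i j : (Xi i == Xi j) = (i == j).
Proof. by rewrite (inj_eq (@lshift_inj _ _)) (inj_eq (@rshift_inj _ _)). Qed.

(** Pointwise form of [ambient_g], with the slice metric abstracted to one matrix [B]; the inverse
    metric then has the same shape. *)
Definition ambient_mx (B : 'M[R]_n) : 'M[R]_(1 + n + 1) :=
  two_du_dv R n + block_mx (block_mx 0 0 0 B) 0 0 0.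

Lemma two_du_dvE k l : two_du_dv R n k l =
  ((k == Ui) && (l == Vi))%:R + ((k == Vi) && (l == Ui))%:R.
Proof. by rewrite !mxE. Qed.

Lemma ambient_mx_xx B i j : ambient_mx B (Xi i) (Xi j) = B i j.
Proof.
by rewrite mxE two_du_dvE !ambient_idx_eq /= block_mxEul block_mxEdr /= !add0r.
Qed.

Lemma ambient_mx_v B k : ambient_mx B Vi k = (k == Ui)%:R.
Proof.
rewrite mxE two_du_dvE !ambient_idx_eq eqxx /= add0r.
suff -> : block_mx (block_mx 0 0 0 B) 0 0 0 Vi k = 0 by rewrite addr0.
case: (ambient_idxP k) => [|i|].
- by rewrite block_mxEul block_mxEul mxE.
- by rewrite block_mxEul block_mxEur mxE.
- by rewrite block_mxEur mxE.
Qed.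

Lemma ambient_mx_u B k : ambient_mx B Ui k = (k == Vi)%:R.
Proof.
rewrite mxE two_du_dvE !ambient_idx_eq eqxx /= addr0.
suff -> : block_mx (block_mx 0 0 0 B) 0 0 0 Ui k = 0 by rewrite addr0.
case: (ambient_idxP k) => [|i|].
- by rewrite block_mxEdl mxE.
- by rewrite block_mxEdl mxE.
- by rewrite block_mxEdr mxE.
Qed.

Lemma trmx_ambient B : (ambient_mx B)^T = ambient_mx B^T.
Proof.
rewrite /ambient_mx /two_du_dv !linearD /= !trmx_delta !tr_block_mx !trmx0.
by rewrite [X in X + _]addrC.
Qed.

Lemma ambient_mxv B k : ambient_mx B k Vi = (k == Ui)%:R.
Proof. by rewrite -(ambient_mx_v B^T) -trmx_ambient [RHS]mxE. Qed.

Lemma ambient_mxu B k : ambient_mx B k Ui = (k == Vi)%:R.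
Proof. by rewrite -(ambient_mx_u B^T) -trmx_ambient [RHS]mxE. Qed.

Lemma sum_ambient_x B i (F : 'I_(1 + n + 1) -> R) :
  \sum_k ambient_mx B (Xi i) k * F k = \sum_k B i k * F (Xi k).
Proof.
rewrite sum_ambient ambient_mxv ambient_mxu !ambient_idx_eq /= !mul0r add0r addr0.
by apply: eq_bigr => k _; rewrite ambient_mx_xx.
Qed.

(** Row v has its only nonzero entry in column u. Applied to the inverse metric, this says that
    raising an index exchanges u and v. *)
Lemma sum_ambient_v B (F : 'I_(1 + n + 1) -> R) :
  \sum_k ambient_mx B Vi k * F k = F Ui.
Proof.
rewrite (bigD1 Ui) //= ambient_mx_v eqxx mul1r big1 ?addr0 // => k /negPf kU.
by rewrite ambient_mx_v kU mul0r.
Qed.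

Lemma sum_ambient_u B (F : 'I_(1 + n + 1) -> R) :
  \sum_k ambient_mx B Ui k * F k = F Vi.
Proof.
rewrite (bigD1 Vi) //= ambient_mx_u eqxx mul1r big1 ?addr0 // => k /negPf kV.
by rewrite ambient_mx_u kV mul0r.
Qed.

Lemma sum2_ambient B (F : 'I_(1 + n + 1) -> 'I_(1 + n + 1) -> R) :
  \sum_k \sum_l ambient_mx B k l * F k l =
  F Vi Ui + \sum_i \sum_j B i j * F (Xi i) (Xi j) + F Ui Vi.
Proof.
rewrite sum_ambient (sum_ambient_v B (F Vi)) (sum_ambient_u B (F Ui)).
by under eq_bigr do rewrite sum_ambient_x.
Qed.

Definition ambient_mxE := (ambient_mx_xx, ambient_mx_v, ambient_mx_u,
  ambient_mxv, ambient_mxu, ambient_idx_eq, eqxx).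

(** The (v, u) block is the swap of two coordinates, which is its own inverse, and it does not
    interact with the block of M. *)
Lemma mul_ambient_mx (A B : 'M[R]_n) (AB1 : A *m B = 1%:M) :
  ambient_mx A *m ambient_mx B = 1%:M.
Proof.
apply/matrixP => k l; rewrite mxE sum_ambient.
case: (ambient_idxP k) => [|i|]; case: (ambient_idxP l) => [|j|];
  (under eq_bigr do rewrite !ambient_mxE ?mulr0 ?mul0r);
  rewrite !ambient_mxE !mxE ?ambient_mxE ?big1_eq ?(mulr0, mulr1) ?(addr0, add0r) //.
have /matrixP/(_ i j) := AB1; rewrite !mxE => ->.
by rewrite x_idx_eq.
Qed.

(* Holds for singular [B] too, because [invmx] is the identity there. *)
Lemma invmx_ambient (B : 'M[R]_n) : invmx (ambient_mx B) = ambient_mx (invmx B).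
Proof.
have [uB|nuB] := boolP (B \in unitmx).
  have := mul_ambient_mx _ _ (mulmxV uB) => BB1.
  have [uAB _] := mulmx1_unit BB1.
  by rewrite -[RHS](mulKmx uAB) BB1 mulmx1.
rewrite [in RHS]/invmx (negPf nuB) invmx_out //.
apply: contra nuB => /mulmxV/matrixP H.
suff BC1 : B *m (\matrix_(i, j) invmx (ambient_mx B) (Xi i) (Xi j)) = 1%:M.
  by have [] := mulmx1_unit BC1.
apply/matrixP => i j; rewrite mxE.
under eq_bigr => k _ do rewrite -(ambient_mx_xx B) [X in _ * X]mxE.
have := H (Xi i) (Xi j); rewrite mxE sum_ambient !ambient_mxE !mul0r addr0 add0r => ->.
by rewrite !mxE x_idx_eq.
Qed.

End AmbientBlocks.

(* Otherwise unification compares distinct indices by computing the shifts. *)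
Opaque v_idx x_idx u_idx.

(** * Partial derivatives in the coordinates (v, x, u) *)

Section AmbientPartials.
Context {R : realType} {n : nat}.
Implicit Types (q : 'rV[R]_(1 + n + 1)) (F : R -> 'rV[R]_n -> R).
Local Notation Vi := (v_idx n).
Local Notation Xi := (@x_idx n).
Local Notation Ui := (u_idx n).

Lemma u_coord_shift h k q : k != Ui -> u_coord (h *: delta_mx 0 k + q) = u_coord q.
Proof. by rewrite /u_coord !mxE /= eq_sym => /negPf ->; rewrite mulr0 add0r. Qed.

Lemma v_coord_shift h k q : k != Vi -> v_coord (h *: delta_mx 0 k + q) = v_coord q.
Proof. by rewrite /v_coord !mxE /= eq_sym => /negPf ->; rewrite mulr0 add0r. Qed.

Lemma shift_x h i q (p := h *: delta_mx 0 (Xi i) + q) :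
  [/\ v_coord p = v_coord q, x_coord p = h *: delta_mx 0 i + x_coord q
    & u_coord p = u_coord q].
Proof.
rewrite /p v_coord_shift ?u_coord_shift ?ambient_idx_eq //; split=> //.
by apply/rowP => j; rewrite !mxE x_idx_eq.
Qed.

Lemma shift_v h q (p := h *: delta_mx 0 Vi + q) :
  [/\ v_coord p = h + v_coord q, x_coord p = x_coord q & u_coord p = u_coord q].
Proof.
rewrite /p u_coord_shift ?ambient_idx_eq //; split=> //.
  by rewrite /v_coord !mxE !eqxx mulr1.
by apply/rowP => j; rewrite !mxE ambient_idx_eq mulr0 add0r.
Qed.

Lemma shift_u h q (p := h *: delta_mx 0 Ui + q) :
  [/\ v_coord p = v_coord q, x_coord p = x_coord q & u_coord p = h + u_coord q].
Proof.
rewrite /p v_coord_shift ?ambient_idx_eq //; split=> //.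
  by apply/rowP => j; rewrite !mxE ambient_idx_eq mulr0 add0r.
by rewrite /u_coord !mxE !eqxx mulr1.
Qed.

Lemma pd_x F i q :
  pd (Xi i) (fun p => F (u_coord p) (x_coord p)) q = pd i (F (u_coord q)) (x_coord q).
Proof. by apply: derive_translation_eq => h; have [_ -> ->] := shift_x h i q. Qed.

Lemma pd_v F q : pd Vi (fun p => F (u_coord p) (x_coord p)) q = 0.
Proof. by apply: derive_translation_invariant => h; have [_ -> ->] := shift_v h q. Qed.

(** With [ambient_potential], the single-chart form of the ambient structure, for arbitrary families
    depending on u. *)
Definition ambient_metric (G : R -> 'rV[R]_n -> 'M[R]_n) q :=
  ambient_mx (G (u_coord q) (x_coord q)).

Definition ambient_potential (f : R -> 'rV[R]_n -> R) q :=
  f (u_coord q) (x_coord q) - v_coord q.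

Lemma pd_ambient_potential_x f i q :
  pd (Xi i) (ambient_potential f) q = pd i (f (u_coord q)) (x_coord q).
Proof.
apply: derive_translation_eq => h; rewrite /ambient_potential.
have [-> -> ->] := shift_x h i q.
by rewrite opprB addrA addrNK.
Qed.

Lemma pd_ambient_potential_u f q :
  pd Ui (ambient_potential f) q = pd Ui (fun p => f (u_coord p) (x_coord p)) q.
Proof.
apply: derive_translation_eq => h; rewrite /ambient_potential.
have [-> _ _] := shift_u h q.
by rewrite opprB addrA addrNK.
Qed.

Lemma pd_ambient_potential_v f q : pd Vi (ambient_potential f) q = -1.
Proof.
(* Increments along v are those of [h |-> - h], so [-1] is written as the derivative of negation on
   the real line. *)
have <- : 'D_(1 : R) (-%R : R -> R) 0 = -1 by rewrite deriveN // derive_id.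
apply: derive_translation_eq => h; rewrite /ambient_potential /=.
have [-> -> ->] := shift_v h q.
by rewrite [h *: 1]mulr1 addr0 oppr0 subr0 opprD opprB !addrA addrNK addrC addKr.
Qed.

(** Translations along u and v commute, so the u-derivative of a function of (u, x) is again
    independent of v. This kills the second derivatives with v outermost. *)
Lemma pd_u_shift_v F h q :
  pd Ui (fun p => F (u_coord p) (x_coord p)) (h *: delta_mx 0 Vi + q) =
  pd Ui (fun p => F (u_coord p) (x_coord p)) q.
Proof.
apply: derive_translation_eq => h'; rewrite addrCA.
by have [_ -> ->] := shift_v h (h' *: delta_mx 0 Ui + q); have [_ -> ->] := shift_v h q.
Qed.

End AmbientPartials.

(** * Curvature, Hessian and gradient of the ambient structure *)

Section AmbientGeometry.
Context {R : realType} {n : nat}.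
Variables (G : R -> 'rV[R]_n -> 'M[R]_n) (f : R -> 'rV[R]_n -> R).
Implicit Types (q : 'rV[R]_(1 + n + 1)).
Local Notation Vi := (v_idx n).
Local Notation Xi := (@x_idx n).
Local Notation Ui := (u_idx n).
Local Notation gt := (ambient_metric G).
Local Notation ft := (ambient_potential f).

Lemma pd_metric_xx k i j q : pd k (fun p => gt p (Xi i) (Xi j)) q =
  pd k (fun p => G (u_coord p) (x_coord p) i j) q.
Proof. by under eq_fun do rewrite ambient_mx_xx. Qed.

Lemma pd_metric_v k l q : pd k (fun p => gt p Vi l) q = 0.
Proof. by under eq_fun do rewrite ambient_mx_v; exact: pd_cst. Qed.

Lemma pd_metricv k l q : pd k (fun p => gt p l Vi) q = 0.
Proof. by under eq_fun do rewrite ambient_mxv; exact: pd_cst. Qed.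

Lemma pd_metric_u k l q : pd k (fun p => gt p Ui l) q = 0.
Proof. by under eq_fun do rewrite ambient_mx_u; exact: pd_cst. Qed.

Lemma pd_metricu k l q : pd k (fun p => gt p l Ui) q = 0.
Proof. by under eq_fun do rewrite ambient_mxu; exact: pd_cst. Qed.

Lemma pd_v_metric k l q : pd Vi (fun p => gt p k l) q = 0.
Proof.
apply: derive_translation_invariant => h.
by rewrite /ambient_metric; have [_ -> ->] := shift_v h q.
Qed.

Lemma ginv_ambient q : ginv gt q = ambient_mx (ginv (G (u_coord q)) (x_coord q)).
Proof. exact: invmx_ambient. Qed.

(** Raising to u selects the lowered index v, where the metric components are constant; the
    remaining term is a v-derivative. *)
Lemma christoffel_u i j : christoffel gt Ui i j = fun=> 0.
Proof.
apply/funext => q; rewrite /christoffel ginv_ambient sum_ambient_u.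
by rewrite pd_metricv pd_metricv pd_v_metric addr0 subr0 mulr0.
Qed.

(** Together with [christoffel_v_r]: the field [d_v] is parallel. *)
Lemma christoffel_v_l k j : christoffel gt k Vi j = fun=> 0.
Proof.
apply/funext => q; rewrite /christoffel big1 ?mulr0 // => l _.
by rewrite pd_v_metric pd_metric_v pd_metric_v addr0 subr0 mulr0.
Qed.

Lemma christoffel_v_r k j : christoffel gt k j Vi = fun=> 0.
Proof.
apply/funext => q; rewrite /christoffel big1 ?mulr0 // => l _.
by rewrite pd_v_metric pd_metric_v pd_metricv addr0 subr0 mulr0.
Qed.

(** Raising to v selects the lowered index u; as [g~_iu] is constant, only the term [- d_u g_ij]
    survives. *)
Lemma christoffel_v_xx i j q : christoffel gt Vi (Xi i) (Xi j) q =
  - (2^-1 * pd Ui (fun p => G (u_coord p) (x_coord p) i j) q).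
Proof.
rewrite /christoffel ginv_ambient sum_ambient_v.
by rewrite pd_metricu pd_metricu pd_metric_xx !add0r mulrN.
Qed.

Lemma christoffel_xxx k i j : christoffel gt (Xi k) (Xi i) (Xi j) =
  fun q => christoffel (G (u_coord q)) k i j (x_coord q).
Proof.
apply/funext => q; rewrite /christoffel ginv_ambient sum_ambient_x.
congr (_ * _); apply: eq_bigr => l _; congr (_ * _).
rewrite !pd_metric_xx (pd_x (fun u x => G u x j l)) (pd_x (fun u x => G u x i l)).
by rewrite (pd_x (fun u x => G u x i j)).
Qed.

(** The first term is the v-derivative of [Gamma^v_ij], which is independent of v; every other term
    has a Christoffel symbol with lower index v. *)
Lemma riemann_v i j q : riemann gt Vi (Xi j) Vi (Xi i) q = 0.
Proof.
rewrite /riemann christoffel_v_l pd_cst subr0 big1 => [|p _].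
  rewrite addr0; apply: derive_translation_invariant => h.
  by rewrite !christoffel_v_xx (pd_u_shift_v (fun u x => G u x i j)).
by rewrite christoffel_v_l mul0r [christoffel gt p Vi _]christoffel_v_l mulr0 subrr.
Qed.

Lemma riemann_u i j q : riemann gt Ui (Xi j) Ui (Xi i) q = 0.
Proof.
rewrite /riemann !christoffel_u !pd_cst subr0 add0r big1 // => p _.
by rewrite !christoffel_u !mul0r subrr.
Qed.

Lemma riemann_x l k i j q : riemann gt (Xi l) (Xi k) (Xi i) (Xi j) q =
  riemann (G (u_coord q)) l k i j (x_coord q).
Proof.
rewrite /riemann; congr (_ - _ + _).
- by rewrite christoffel_xxx (pd_x (fun u x => christoffel (G u) l j k x)).
- by rewrite christoffel_xxx (pd_x (fun u x => christoffel (G u) l i k x)).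
(* For [p] = v a factor has lower index v; for [p] = u a factor has upper index u. *)
rewrite sum_ambient !christoffel_v_r !christoffel_u !mul0r !mulr0 !subr0 add0r addr0.
by apply: eq_bigr => p _; rewrite 4!christoffel_xxx.
Qed.

Lemma ricci_ambient i j q :
  ricci gt (Xi i) (Xi j) q = ricci (G (u_coord q)) i j (x_coord q).
Proof.
rewrite /ricci sum_ambient riemann_v riemann_u add0r addr0.
by apply: eq_bigr => k _; rewrite riemann_x.
Qed.

(** The correction is the term [k] = v: [- Gamma^v_ij d_v phi~], with [Gamma^v_ij = - g'_ij / 2] and
    [d_v phi~ = -1]. *)
Lemma hessian_ambient_xx i j q : hessian gt ft (Xi i) (Xi j) q =
  hessian (G (u_coord q)) (f (u_coord q)) i j (x_coord q)
  - 2^-1 * pd Ui (fun p => G (u_coord p) (x_coord p) i j) q.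
Proof.
rewrite /hessian (_ : pd (Xi j) ft = fun p => pd j (f (u_coord p)) (x_coord p)); last first.
  by apply/funext => p; rewrite pd_ambient_potential_x.
rewrite (pd_x (fun u x => pd j (f u) x)) sum_ambient christoffel_u mul0r addr0.
rewrite christoffel_v_xx pd_ambient_potential_v mulrN1 opprK opprD addrCA addrC -addrA.
rewrite [in RHS]addrAC -!addrA; congr (_ + _); rewrite addrC; congr (_ + - _).
by apply: eq_bigr => k _; rewrite christoffel_xxx pd_ambient_potential_x.
Qed.

Lemma hessian_ambient_uv q : hessian gt ft Ui Vi q = 0.
Proof.
rewrite /hessian (_ : pd Vi ft = fun=> -1); last first.
  by apply/funext => p; rewrite pd_ambient_potential_v.
rewrite pd_cst big1 ?subr0 // => k _.
by rewrite christoffel_v_r mul0r.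
Qed.

Lemma hessian_ambient_vu q : hessian gt ft Vi Ui q = 0.
Proof.
rewrite /hessian big1 => [|k _]; last by rewrite christoffel_v_l mul0r.
rewrite subr0; apply: derive_translation_invariant => h.
by rewrite !pd_ambient_potential_u pd_u_shift_v.
Qed.

Lemma laplacian_ambient q : laplacian gt ft q =
  laplacian (G (u_coord q)) (f (u_coord q)) (x_coord q)
  - 2^-1 * \sum_i \sum_j ginv (G (u_coord q)) (x_coord q) i j
                    * pd Ui (fun p => G (u_coord p) (x_coord p) i j) q.
Proof.
rewrite /laplacian ginv_ambient sum2_ambient hessian_ambient_uv hessian_ambient_vu.
rewrite add0r addr0 mulr_sumr -sumrB; apply: eq_bigr => i _.
rewrite mulr_sumr -sumrB; apply: eq_bigr => j _.
by rewrite hessian_ambient_xx mulrBr [2^-1 * (_ * _)]mulrCA.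
Qed.

(** The two cross terms [d_u phi~ d_v phi~] each contribute [- phi']. *)
Lemma grad_sq_ambient q : grad_sq gt ft q =
  grad_sq (G (u_coord q)) (f (u_coord q)) (x_coord q)
  - 2 * pd Ui (fun p => f (u_coord p) (x_coord p)) q.
Proof.
rewrite /grad_sq ginv_ambient.
under eq_bigr do under eq_bigr do rewrite -mulrA.
rewrite sum2_ambient pd_ambient_potential_v pd_ambient_potential_u mulN1r mulrN1.
rewrite addrAC -opprD -mulr2n [2 * _]mulr_natl addrC; congr (_ - _).
apply: eq_bigr => i _; apply: eq_bigr => j _.
by rewrite !pd_ambient_potential_x mulrA.
Qed.

End AmbientGeometry.

(** * Continuity of the inverse matrix *)

Section MatrixContinuity.
Context {R : realType} {T : Type} {F : set_system T} {FF : Filter F}.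

Lemma cvg_det n (A : T -> 'M[R]_n) (B : 'M[R]_n) :
  (forall i j, A x i j @[x --> F] --> B i j) -> \det (A x) @[x --> F] --> \det B.
Proof.
move=> AB; apply: (cvg_big (add_continuous)) => s _.
by apply: cvgM; [exact: cvg_cst | apply: (cvg_big mul_continuous) => i _].
Qed.

(** By the cofactor formula, the inverse is a quotient of polynomials in the entries; the formula
    applies along the filter because the determinant is eventually nonzero. *)
Lemma cvg_invmx n (A : T -> 'M[R]_n) (B : 'M[R]_n) : B \in unitmx ->
  (forall i j, A x i j @[x --> F] --> B i j) ->
  forall i j, invmx (A x) i j @[x --> F] --> invmx B i j.
Proof.
move=> uB AB i j; have detB : \det B != 0 by rewrite -unitfE -unitmxE.
have invE (C : 'M[R]_n) : \det C != 0 -> (\det C)^-1 * \adj C i j = invmx C i j.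
  by rewrite -unitfE -unitmxE => uC; rewrite /invmx uC [RHS]mxE.
rewrite -invE //; apply: cvg_trans.
  apply: near_eq_cvg; near=> x; apply: invE.
  by near: x; apply: cvgr_neq0 detB; exact: cvg_det.
apply: cvgM; first by apply: cvgV => //; exact: cvg_det.
rewrite mxE; under eq_fun do rewrite mxE.
apply: cvgM; first exact: cvg_cst.
by apply: cvg_det => k l; rewrite !mxE; under eq_fun do rewrite !mxE; exact: AB.
Unshelve. all: by end_near. Qed.

End MatrixContinuity.

(** A nonzero kernel vector would make the quadratic form vanish. *)
Lemma unitmx_definite {R : realType} {n : nat} (B : 'M[R]_n) :
  (forall w : 'rV[R]_n, w != 0 -> 0 < (w *m B *m w^T) 0 0) -> B \in unitmx.
Proof.
move=> Bpos; rewrite unitmxE unitfE; apply/negP => /det0P[w w0 wB].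
by have := Bpos w w0; rewrite wB mul0mx mxE ltxx.
Qed.

(** * Stability of [O(u^oo)] under sums and continuous factors *)

Section BigO.
Context {R : realType} {n : nat}.
Variable (U : set 'rV[R]_(1 + n + 1)).
Implicit Types f h b : 'rV[R]_(1 + n + 1) -> R.

Lemma O_u_inftyD f h : O_u_infty U f -> O_u_infty U h ->
  O_u_infty U (fun q => f q + h q).
Proof.
move=> fO hO N q Uq uq.
have /eqO_exP[k k0 fk] := fO N q Uq uq; have /eqO_exP[l l0 hl] := hO N q Uq uq.
apply/eqO_exP; exists (k + l); first exact: addr_gt0.
near=> p; rewrite (le_trans (ler_normD _ _)) // mulrDl lerD //.
  by near: p.
by near: p.
Unshelve. all: by end_near. Qed.

(** Continuity bounds the factor by [|b q| + 1] near [q], which only enlarges the constant. *)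
Lemma O_u_inftyM b f :
  (forall q, U q -> u_coord q = 0 -> {for q, continuous b}) ->
  O_u_infty U f -> O_u_infty U (fun q => b q * f q).
Proof.
move=> bc fO N q Uq uq; have /eqO_exP[k k0 fk] := fO N q Uq uq.
apply/eqO_exP; exists ((`|b q| + 1) * k); first by rewrite mulr_gt0 // ltr_wpDl.
near=> p; rewrite normrM -mulrA ler_pM //.
  near: p; apply: (cvgr_le `|b q|); last by rewrite ltrDl.
  by apply: cvg_norm; exact: bc.
by near: p.
Unshelve. all: by end_near. Qed.

Lemma O_u_infty0 : O_u_infty U (fun=> 0).
Proof.
move=> N q Uq uq; apply/eqO_exP; exists 1 => //.
by near=> p; rewrite normr0 mulr_ge0.
Unshelve. all: by end_near. Qed.

Lemma O_u_infty_sum (I : finType) (f : I -> 'rV[R]_(1 + n + 1) -> R) :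
  (forall i, O_u_infty U (f i)) -> O_u_infty U (fun q => \sum_i f i q).
Proof.
move=> fO; elim: (index_enum I) => [|i s IH].
  by under [X in O_u_infty _ X]eq_fun do rewrite big_nil; exact: O_u_infty0.
under [X in O_u_infty _ X]eq_fun do rewrite big_cons.
exact: O_u_inftyD.
Qed.

End BigO.

(** * Lie derivatives along X in terms of [P~] and [F~] *)

Section FlowField.
Context {R : realType} {n : nat} {M : smooth_manifold R n}.
Variables (gu : R -> atlas_index M -> 'rV[R]_n -> 'M[R]_n) (phiu : R -> M -> R).
Variable a : atlas_index M.
Local Notation Vi := (v_idx n).
Local Notation Xi := (@x_idx n).
Local Notation Ui := (u_idx n).
Local Notation X := (flow_field gu phiu a).
Local Notation g_ := (fun u => gu u a).
Local Notation phi_ := (fun u => loc_fun a (phiu u)).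
Implicit Type q : 'rV[R]_(1 + n + 1).

Lemma flow_field_v q : X q 0 Vi =
  v1_phi (gu (u_coord q) a) (loc_fun a (phiu (u_coord q))) (x_coord q).
Proof. by rewrite !mxE !eqxx ambient_idx_eq mulr1 subr0. Qed.

Lemma flow_field_x i q : X q 0 (Xi i) = 0.
Proof. by rewrite !mxE !ambient_idx_eq mulr0 subr0. Qed.

Lemma flow_field_u q : X q 0 Ui = -1.
Proof. by rewrite !mxE !eqxx ambient_idx_eq mulr0 sub0r. Qed.

(** Subtracting the constant [2 du dv] lets the entries be read off from those of [ambient_mx]. *)
Lemma gu_tensorE q k l :
  gu_tensor gu a q k l = ambient_metric g_ q k l - two_du_dv R n k l.
Proof. by rewrite [ambient_metric _ _ _ _]mxE addrAC subrr add0r. Qed.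

Lemma gu_tensor_xx q i j :
  gu_tensor gu a q (Xi i) (Xi j) = gu (u_coord q) a (x_coord q) i j.
Proof. by rewrite gu_tensorE two_du_dvE !ambient_idx_eq ambient_mx_xx addr0 subr0. Qed.

Lemma gu_tensor_v q k : gu_tensor gu a q Vi k = 0.
Proof. by rewrite gu_tensorE two_du_dvE ambient_mx_v ambient_idx_eq eqxx add0r subrr. Qed.

Lemma gu_tensorv q k : gu_tensor gu a q k Vi = 0.
Proof.
by rewrite gu_tensorE two_du_dvE ambient_mxv ambient_idx_eq eqxx andbF andbT addr0 subrr.
Qed.

Lemma gu_tensor_u q k : gu_tensor gu a q Ui k = 0.
Proof. by rewrite gu_tensorE two_du_dvE ambient_mx_u ambient_idx_eq eqxx addr0 subrr. Qed.

Lemma gu_tensoru q k : gu_tensor gu a q k Ui = 0.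
Proof.
by rewrite gu_tensorE two_du_dvE ambient_mxu ambient_idx_eq eqxx andbF andbT add0r subrr.
Qed.

(** The terms [T_kj d_i X^k] and [T_ik d_j X^k] vanish: for [k] in M because [X^k = 0], for [k] = v
    or u because [g_u] has no such components. Hence no derivative of [v_1] enters. *)
Lemma lie_gu_tensor i j q : lie_cov2 X (gu_tensor gu a) (Xi i) (Xi j) q =
  - pd Ui (fun p => gu (u_coord p) a (x_coord p) i j) q.
Proof.
have pdX k l : pd k (fun p => X p 0 (Xi l)) q = 0.
  by under eq_fun do rewrite flow_field_x; exact: pd_cst.
have E (x y z y' z' w c : R) :
    x * 0 + 0 * y + 0 * z + 0 + (c * w + 0 * y' + 0 * z') = c * w by ring.
rewrite /lie_cov2 sum_ambient big1 => [|k _]; last first.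
  by rewrite !pdX flow_field_x mul0r 2!mulr0 2!addr0.
rewrite (gu_tensor_v q (Xi j)) (gu_tensorv q (Xi i)).
rewrite (gu_tensor_u q (Xi j)) (gu_tensoru q (Xi i)).
under [X in _ * pd _ X _]eq_fun do rewrite gu_tensor_xx.
under [X in _ + (_ * pd _ X _ + _ + _)]eq_fun do rewrite gu_tensor_xx.
(* The v-term drops since [g_u] is independent of v; [-1] is turned back into [X^u] so that the goal
   is an instance of [E]. *)
rewrite (pd_v (fun u x => gu u a x i j)) -[RHS]mulN1r -(flow_field_u q).
exact: E.
Qed.

Lemma lie_ambient_phi q : lie_fun X (ambient_phi phiu a) q =
  - v1_phi (gu (u_coord q) a) (loc_fun a (phiu (u_coord q))) (x_coord q)
  - pd Ui (fun p => loc_fun a (phiu (u_coord p)) (x_coord p)) q.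
Proof.
rewrite /lie_fun sum_ambient big1 => [|k _]; last by rewrite flow_field_x mul0r.
rewrite flow_field_v flow_field_u addr0 mulN1r.
by rewrite (pd_ambient_potential_v phi_) (pd_ambient_potential_u phi_) mulrN1.
Qed.

Lemma P_phi_ambient i j q :
  P_phi (ambient_g gu a) (ambient_phi phiu a) 0 (Xi i) (Xi j) q =
  ric_phi (gu (u_coord q) a) (loc_fun a (phiu (u_coord q))) i j (x_coord q)
  - 2^-1 * pd Ui (fun p => gu (u_coord p) a (x_coord p) i j) q.
Proof.
rewrite /P_phi /ric_phi mul0r subr0 -[ambient_g gu a]/(ambient_metric g_).
by rewrite ricci_ambient (hessian_ambient_xx g_ phi_) addrA.
Qed.

Lemma F_phi_ambient q : F_phi (ambient_g gu a) (ambient_phi phiu a) 0 q =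
  laplacian (gu (u_coord q) a) (loc_fun a (phiu (u_coord q))) (x_coord q)
  - 2^-1 * (\sum_i \sum_j ginv (gu (u_coord q) a) (x_coord q) i j
                    * pd Ui (fun p => gu (u_coord p) a (x_coord p) i j) q)
  - (grad_sq (gu (u_coord q) a) (loc_fun a (phiu (u_coord q))) (x_coord q)
     - 2 * pd Ui (fun p => loc_fun a (phiu (u_coord p)) (x_coord p)) q).
Proof.
rewrite /F_phi !mulr0 mul0r subr0 addr0.
by rewrite (laplacian_ambient g_ phi_) (grad_sq_ambient g_ phi_).
Qed.

Lemma lie_gu_tensor_P_phi i j q :
  lie_cov2 X (gu_tensor gu a) (Xi i) (Xi j) q
  - (- 2 * ric_phi (gu (u_coord q) a) (loc_fun a (phiu (u_coord q))) i j (x_coord q)) =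
  2 * P_phi (ambient_g gu a) (ambient_phi phiu a) 0 (Xi i) (Xi j) q.
Proof. by rewrite lie_gu_tensor P_phi_ambient; field. Qed.

Lemma trace_P_phi_ambient q :
  \sum_i \sum_j ginv (gu (u_coord q) a) (x_coord q) i j
       * P_phi (ambient_g gu a) (ambient_phi phiu a) 0 (Xi i) (Xi j) q =
  scalar_curv (gu (u_coord q) a) (x_coord q)
  + laplacian (gu (u_coord q) a) (loc_fun a (phiu (u_coord q))) (x_coord q)
  - 2^-1 * (\sum_i \sum_j ginv (gu (u_coord q) a) (x_coord q) i j
                    * pd Ui (fun p => gu (u_coord p) a (x_coord p) i j) q).
Proof.
rewrite /scalar_curv /laplacian mulr_sumr -big_split -sumrB; apply: eq_bigr => i _ /=.
rewrite mulr_sumr -big_split -sumrB; apply: eq_bigr => j _ /=.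
by rewrite P_phi_ambient /ric_phi; ring.
Qed.

(** In [tr P~ - F~] the common part [Delta phi - tr g' / 2] cancels, leaving
    [R + |nabla phi|^2 - 2 phi']. The factor [1/2] stays inside the sum so that each summand is a
    coefficient times [P~_ij]. *)
Lemma lie_ambient_phi_P_F_phi q :
  lie_fun X (ambient_phi phiu a) q
  - (- (scalar_curv (gu (u_coord q) a) (x_coord q)
        + laplacian (gu (u_coord q) a) (loc_fun a (phiu (u_coord q))) (x_coord q))) =
  - 2^-1 * F_phi (ambient_g gu a) (ambient_phi phiu a) 0 q
  + \sum_i \sum_j 2^-1 * ginv (gu (u_coord q) a) (x_coord q) i j
       * P_phi (ambient_g gu a) (ambient_phi phiu a) 0 (Xi i) (Xi j) q.
Proof.
under [X in _ = _ + X]eq_bigr do (under eq_bigr do rewrite -mulrA; rewrite -mulr_sumr).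
rewrite -mulr_sumr trace_P_phi_ambient F_phi_ambient lie_ambient_phi /v1_phi.
by field.
Qed.

End FlowField.

Theorem theorem1p4 (R : realType) (n : nat) (D : density_manifold R n)
    (lambda0 : dm_lambda D = 0) (A : normal_weighted_ambient D)
    (a : atlas_index D) :
  let X := flow_field (amb_gu A) (amb_phiu A) a in
  let g_ u := amb_gu A u a in
  let phi_ u := loc_fun a (amb_phiu A u) in
  (forall i j : 'I_n,
     O_u_infty (ambient_img (amb_dom (D := D) A) a)
       (fun q => lie_cov2 X (gu_tensor (amb_gu A) a) (x_idx i) (x_idx j) q
          - (- 2 * ric_phi (g_ (u_coord q)) (phi_ (u_coord q)) i j (x_coord q))))
  /\ O_u_infty (ambient_img (amb_dom (D := D) A) a)
       (fun q => lie_fun X (ambient_phi (amb_phiu A) a) q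
          - (- (scalar_curv (g_ (u_coord q)) (x_coord q)
                + laplacian (g_ (u_coord q)) (phi_ (u_coord q)) (x_coord q)))).
Proof.
move=> X g_ phi_.
have := @amb_P _ _ _ A a; have := @amb_F _ _ _ A a; rewrite lambda0 => FO PO.
split=> [i j|].
  under [X in O_u_infty _ X]eq_fun do rewrite lie_gu_tensor_P_phi.
  by apply: O_u_inftyM (PO _ _) => q _ _; exact: cst_continuous.
under [X in O_u_infty _ X]eq_fun do rewrite lie_ambient_phi_P_F_phi.
apply: O_u_inftyD; first by apply: O_u_inftyM FO => q _ _; exact: cst_continuous.
apply: O_u_infty_sum => i; apply: O_u_infty_sum => j.
apply: O_u_inftyM (PO _ _) => q [imgq domq] _.
have [_ _ g_pos _] := @amb_gu_metric _ _ _ A (u_coord q).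
have g_unit : amb_gu A (u_coord q) a (x_coord q) \in unitmx.
  (* The v-coordinate of [q] witnesses that its point of M lies in the slice where [g_u] is a
     metric. *)
  by apply: unitmx_definite; apply: g_pos => //; exists (v_coord q).
apply: continuousM; first exact: cst_continuous.
apply: (cvg_invmx (F := nbhs q) n (fun p => amb_gu A (u_coord p) a (x_coord p)) _ g_unit) => k l.
(* The empty list of derivatives in [smooth_on] gives differentiability of the entry itself. *)
exact: (differentiable_continuous (@amb_gu_smooth _ _ _ A a k l [::] q (conj imgq domq))).
Qed.
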